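(* Let $G$ be a hyperforest on the vertex set $\{x_1,\ldots,x_n\}$ with at least one edge of cardinality at least $2$, and let $I = I(G) \subseteq R = k[x_1,\ldots,x_n]$ be its edge ideal, where $k$ is an arbitrary field. Let $\epsilon(G)$ be the edgewise domination number of $G$. Then for all integers $s \geq 1$, $$\operatorname{depth} R/I^s \geq \max\{\epsilon(G)-s+1,\ 1\}.$$
   Context: A hypergraph $G=(V_G,E_G)$ consists of a vertex set $V_G=\{x_1,\ldots,x_n\}$, identified with the variables of the polynomial ring $R=k[x_1,\ldots,x_n]$, and a set $E_G$ of subsets of $V_G$, called edges. All hypergraphs are assumed to be simple, that is, there are no containments among the edges. Edges of cardinality one are allowed. The edge ideal of $G$ is $I(G) = \left\langle \prod_{x\in e} x \mid e \in E_G\right\rangle \subseteq R$. An edge $e\in E_G$ is a leaf if either $e$ is the only edge in $G$, or there exists an edge $g\in E_G$ with $g \neq e$ such that $e\cap h \subseteq e\cap g$ for every edge $h\neq e$. The hypergraph $G$ is a hyperforest (also called a simplicial forest) if every subhypergraph of $G$ contains a leaf, where a subhypergraph is given by a nonempty subset of the edges of $G$. Two vertices are adjacent (neighbors) if there is an edge of $G$ containing both. A subset $F\subseteq E_G$ is edgewise dominant if for every vertex $v\in V_G$ either $\{v\}\in E_G$ or $v$ is adjacent to a vertex contained in an edge of $F$. The edgewise domination number of $G$ is $\epsilon(G)=\min\{|F| \mid F\subseteq E_G \text{ is edgewise dominant}\}$. Depth is taken with respect to the homogeneous maximal ideal $(x_1,\ldots,x_n)$. *)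

(* Defs.v *)
From HB Require Import structures.
From mathcomp Require Import all_boot all_order all_algebra.
From mathcomp Require Import mpoly.
From Stdlib Require Import Classical ClassicalEpsilon.

Set Implicit Arguments.
Unset Strict Implicit.
Unset Printing Implicit Defensive.

Import GRing.Theory.

(** Hypergraphs on the vertex set 'I_n. *)

Definition simple_edges (n : nat) (E : {set {set 'I_n}}) : Prop :=
  forall e f : {set 'I_n}, e \in E -> f \in E -> e \subset f -> e = f.

Record hypergraph (n : nat) := Hypergraph {
  edges :> {set {set 'I_n}};
  edges_simple : simple_edges edges
}.

Definition leaf (n : nat) (E : {set {set 'I_n}}) (e : {set 'I_n}) : Prop :=
  e \in E /\
  (E = [set e] \/
   exists g : {set 'I_n},
     [/\ g \in E, g != e &
         forall h : {set 'I_n},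
           h \in E -> h != e -> e :&: h \subset e :&: g]).

Definition hyperforest (n : nat) (G : hypergraph n) : Prop :=
  forall E' : {set {set 'I_n}},
    E' \subset G -> E' != set0 -> exists e : {set 'I_n}, leaf E' e.

Definition adjacent (n : nat) (G : hypergraph n) (v w : 'I_n) : bool :=
  (v != w) && [exists e in edges G, (v \in e) && (w \in e)].

Definition edgewise_dominant (n : nat) (G : hypergraph n)
    (F : {set {set 'I_n}}) : bool :=
  (F \subset G) &&
  [forall v : 'I_n,
     ([set v] \in edges G) ||
     [exists w : 'I_n, adjacent G v w && [exists f in F, w \in f]]].

(** The minimum is over a nonempty family exactly when every vertex lies in
    some edge; the value is 0 by convention otherwise. *)
Definition edgewise_domination_number (n : nat) (G : hypergraph n) : nat :=
  if [pick F | edgewise_dominant G F] is Some F0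
  then #|[arg min_(F < F0 | edgewise_dominant G F) #|F|]|
  else 0.

Lemma edgewise_domination_numberP (n : nat) (G : hypergraph n)
    (F0 : {set {set 'I_n}}) :
  edgewise_dominant G F0 ->
  (exists2 F, edgewise_dominant G F & #|F| = edgewise_domination_number G) /\
  (forall F, edgewise_dominant G F -> edgewise_domination_number G <= #|F|).
Proof.
rewrite /edgewise_domination_number => domF0.
case: pickP => [F1 domF1|/(_ F0)]; last by rewrite domF0.
by case: arg_minnP => // F domF minF; split=> //; exists F.
Qed.

(** Ideals are Prop-valued predicates on the ring. *)

Definition ideal_gen (A : comNzRingType) (S : A -> Prop) (p : A) : Prop :=
  exists r : seq (A * A),
    (forall c : A * A, c \in r -> S c.2) /\
    p = (\sum_(c <- r) c.1 * c.2)%R.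

Definition ideal_pow (A : comNzRingType) (J : A -> Prop) (s : nat) : A -> Prop :=
  ideal_gen (fun p : A =>
    exists f : 'I_s -> A, (forall i, J (f i)) /\ p = (\prod_i f i)%R).

(** The ideal J + (fs). *)
Definition ideal_adjoin (A : comNzRingType) (J : A -> Prop) (fs : seq A) :
    A -> Prop :=
  ideal_gen (fun p : A => J p \/ p \in fs).

(** [fs] is an (A/J)-regular sequence of elements of [a]; statements about
    (A/J)/(f_1, ..., f_i)(A/J) = A/(J + (f_1, ..., f_i)) are lifted to A. *)
Definition regular_seq (A : comNzRingType) (a J : A -> Prop) (fs : seq A) :
    Prop :=
  [/\ forall f : A, f \in fs -> a f,
      forall i : nat, i < size fs ->
        forall p : A, ideal_adjoin J (take i fs) (nth 0%R fs i * p)%R ->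
                      ideal_adjoin J (take i fs) p
    & ~ ideal_adjoin J fs 1%R].

(** Depth of A/J with respect to the ideal [a]: infinite (encoded as [None])
    if a(A/J) = A/J, that is J + a = A, and otherwise the supremum in
    {0, 1, ..., oo} of the lengths of the (A/J)-regular sequences in [a]. *)
Definition is_depth (A : comNzRingType) (a J : A -> Prop) (x : option nat) :
    Prop :=
  let degenerate := ideal_gen (fun p : A => J p \/ a p) 1%R in
  let upper_bound b := forall fs : seq A, regular_seq a J fs -> size fs <= b in
  match x with
  | Some d =>
      [/\ ~ degenerate, upper_bound d & forall b, upper_bound b -> d <= b]
  | None => degenerate \/ ~ exists b, upper_bound b
  end.

Definition depth (A : comNzRingType) (a J : A -> Prop) : option nat :=
  epsilon (inhabits None) (is_depth a J).

Lemma depthP (A : comNzRingType) (a J : A -> Prop) : is_depth a J (depth a J).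
Proof.
apply: epsilon_spec.
pose ub b := forall fs : seq A, regular_seq a J fs -> size fs <= b.
case: (classic (ideal_gen (fun p : A => J p \/ a p) 1%R)) => [deg|ndeg].
  by exists None; left.
case: (classic (exists b, ub b)) => [[b ubb]|nub]; last by exists None; right.
pose P (m : nat) : bool :=
  if excluded_middle_informative (ub m) then true else false.
have PP m : P m <-> ub m by rewrite /P; case: excluded_middle_informative.
have exP : exists m, P m by exists b; apply/PP.
case: (ex_minnP exP) => d /PP ubd mind.
by exists (Some d); split=> // c ubc; apply: mind; apply/PP.
Qed.

Lemma is_depth_unique (A : comNzRingType) (a J : A -> Prop)
    (x y : option nat) :
  is_depth a J x -> is_depth a J y -> x = y.
Proof.
case: x => [d|]; case: y => [e|] //=.
- move=> [_ ubd mind] [_ ube mine]; congr Some.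
  by apply/eqP; rewrite eqn_leq mind // mine.
- by move=> [ndeg ubd _] [//|[]]; exists d.
- by move=> [deg|nub] [ndeg ube _] //; case: nub; exists e.
Qed.

(** [d <= x] in {0, 1, ..., oo}. *)
Definition le_enat (d : nat) (x : option nat) : bool :=
  if x is Some m then d <= m else true.

Definition edge_ideal (k : fieldType) (n : nat) (G : hypergraph n) :
    {mpoly k[n]} -> Prop :=
  ideal_gen (fun p : {mpoly k[n]} =>
    exists2 e : {set 'I_n}, e \in edges G & p = (\prod_(i in e) 'X_i)%R).

Definition homog_max_ideal (k : fieldType) (n : nat) : {mpoly k[n]} -> Prop :=
  ideal_gen (fun p : {mpoly k[n]} => exists i : 'I_n, p = 'X_i%R).

(* Main.v *)
Require Import Defs.
From mathcomp Require Import all_boot all_order all_algebra all_fingroup.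
From mathcomp Require Import mpoly.
From mathcomp Require Import zify ring.

(** A single sequence of elements serves for all the ideals involved: the
    elementary symmetric polynomials e_1, ..., e_d in all the variables form a
    weakly regular sequence on R/(K) for every set K of at most n - d
    variables, and if they do so on R/(J : x) and R/(J, x), then also on R/J.
    It thus suffices to reduce I^s to ideals (K) by adding and dividing by
    variables.  A family E of edges, a set K of killed variables and a set W of
    divided variables encode the ideal (I(E)^s + (K)) : x_W, and the bound
    d + s <= |F| + 1 is carried along for those dominating F whose edges cover
    W.  For every vertex z of an edge e, the sum with z leads to the edges
    avoiding z, and the colon to W + z.  If e is a good leaf (the sets e :&: h,
    for h in E, form a chain) and W contains e, then I^s : x_W is
    I^(s-1) : x_(W - e), and e can be added to a dominating set.  Good leaves
    exist because E contains no special cycle: the first edge in a doubly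
    lexical ordering of the incidence matrix is one. *)

Set Implicit Arguments.
Unset Strict Implicit.
Unset Printing Implicit Defensive.

(** * Good leaves of hyperforests *)

Lemma sum_pow2_lt (T : finType) (q : T -> nat) (m : nat) :
  injective q -> \sum_(x | q x < m) 2 ^ q x < 2 ^ m.
Proof.
move=> inj_q; elim: m => [|m IH]; first by rewrite big_pred0.
rewrite (bigID (fun x => q x == m)) /=.
have -> : \sum_(x | (q x < m.+1) && (q x != m)) 2 ^ q x =
          \sum_(x | q x < m) 2 ^ q x.
  by apply: eq_bigl => x; lia.
have le1 : \sum_(x | (q x < m.+1) && (q x == m)) 2 ^ q x <= 2 ^ m.
  case: (pickP (fun x => q x == m)) => [x0 /eqP qx0|none].
    rewrite (big_pred1 x0) ?qx0 // => x /=.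
    apply/andP/eqP => [[_ /eqP qx]|->]; first by apply: inj_q; rewrite qx.
    by rewrite qx0 ltnSn.
  by rewrite big_pred0 // => x; rewrite none andbF.
by rewrite expnS mul2n -addnn -addnS leq_add.
Qed.

(** Along increasing [p] the rows weakly increase lexicographically, columns of larger [q] being
    compared first; [c'] is the last column in which the two rows differ. *)
Definition lex_sorted (T1 T2 : finType) (A : T1 -> T2 -> bool)
    (p : T1 -> nat) (q : T2 -> nat) : Prop :=
  forall r r' c, p r < p r' -> A r c -> ~~ A r' c ->
  exists c', [/\ q c < q c', ~~ A r c', A r' c' &
                 forall d, q c' < q d -> A r d = A r' d].

(** The sum reads a row as a binary number with digit [A r c] in place [q c], and numbers compare as
    their digits do from the highest place down. *)
Lemma lex_sorted_of_weight (T1 T2 : finType) (A : T1 -> T2 -> bool)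
    (p : T1 -> nat) (q : T2 -> nat) :
  injective q ->
  (forall r r', p r < p r' ->
     \sum_(c | A r c) 2 ^ q c <= \sum_(c | A r' c) 2 ^ q c) ->
  lex_sorted A p q.
Proof.
move=> inj_q le_w r r' c /le_w {le_w}le_w Arc Ar'c.
pose D d := A r d != A r' d.
have Dc : D c by rewrite /D Arc (negbTE Ar'c).
case: (@arg_maxnP _ c D q Dc) => c' Dc' maxc'.
have agree d : q c' < q d -> A r d = A r' d.
  move=> lt_d; apply/eqP; apply: contraTT lt_d => Dd.
  by rewrite -leqNgt; apply: maxc'.
suff Ar'c' : A r' c'.
  exists c'; split=> //; last by move: Dc'; rewrite /D Ar'c'; case: (A r c').
  rewrite ltn_neqAle; apply/andP; split; last exact: maxc'.
  by apply: contraNneq Ar'c => /inj_q ->.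
apply: contraLR le_w => Ar'c'; rewrite -ltnNge.
have Arc' : A r c' by move: Dc'; rewrite /D (negbTE Ar'c'); case: (A r c').
pose X := \sum_(d | A r d && (q c' < q d)) 2 ^ q d.
have le1 : X + 2 ^ q c' <= \sum_(d | A r d) 2 ^ q d.
  rewrite [leqRHS](bigID (fun d => q c' < q d)) /= leq_add2l.
  by rewrite (bigD1 c') ?Arc' ?ltnn //= leq_addr.
have lt2 : \sum_(d | A r' d) 2 ^ q d < X + 2 ^ q c'.
  rewrite (bigID (fun d => q c' < q d)) /=.
  have -> : \sum_(d | A r' d && (q c' < q d)) 2 ^ q d = X.
    by apply: eq_bigl => d; case: ltnP => [/agree ->|]; rewrite ?andbF.
  rewrite -addnS leq_add2l; apply: leq_ltn_trans (sum_pow2_lt _ inj_q).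
  rewrite big_mkcond [leqRHS]big_mkcond /=; apply: leq_sum => d _.
  case: ifP => // /andP[Ar'd]; rewrite -leqNgt leq_eqVlt => /orP[/eqP/inj_q dc'|->//].
  by move: Ar'c'; rewrite -dc' Ar'd.
exact: leq_trans lt2 le1.
Qed.

(** Composing [s] with the transposition of [x] and [y] changes only two terms; if [R y < R x],
    giving the larger power of 2 to [x] would increase the sum. *)
Lemma max_perm_sorted (T : finType) (R : T -> nat) (s : {perm T}) :
  (forall s' : {perm T}, \sum_x 2 ^ enum_rank (s' x) * R x <=
                         \sum_x 2 ^ enum_rank (s x) * R x) ->
  forall x y, enum_rank (s x) < enum_rank (s y) -> R x <= R y.
Proof.
move=> max_s x y lt_xy.
have neq_yx : y != x by apply: contraTneq lt_xy => ->; rewrite ltnn.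
have := max_s (tperm x y * s)%g.
rewrite (bigD1 x) //= (bigD1 y) //= [leqRHS](bigD1 x) //=.
rewrite [in leqRHS](bigD1 y) //= !permM tpermL tpermR.
rewrite (eq_bigr (fun i => 2 ^ enum_rank (s i) * R i)); last first.
  by move=> z /andP[zx zy]; rewrite permM tpermD // eq_sym.
rewrite !addnA leq_add2r.
have : 2 ^ enum_rank (s x) < 2 ^ enum_rank (s y) by rewrite ltn_exp2l.
move: (2 ^ enum_rank (s x)) (2 ^ enum_rank (s y)) => a b lt_ab.
case: (leqP (R x) (R y)) => // lt_R.
have -> : b = a + (b - a) by rewrite subnKC // ltnW.
have : 0 < (b - a) * (R x - R y) by rewrite muln_gt0 !subn_gt0 lt_ab.
nia.
Qed.

(* The two permutations maximize the sum of 2 ^ (p r + q c) over the nonzero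
   entries; exchanging two rows, or two columns, cannot increase it. *)
Lemma doubly_lexical (T1 T2 : finType) (A : T1 -> T2 -> bool) :
  exists p : T1 -> nat, exists q : T2 -> nat,
  [/\ injective p, injective q, lex_sorted A p q &
      lex_sorted (fun c r => A r c) q p].
Proof.
pose W (st : {perm T1} * {perm T2}) :=
  \sum_r \sum_(c | A r c) 2 ^ enum_rank (st.1 r) * 2 ^ enum_rank (st.2 c).
case: (@arg_maxnP _ (1%g, 1%g) predT W isT) => -[s t] _ max_st.
have inj_rank (T : finType) (u : {perm T}) :
  injective (fun x => nat_of_ord (enum_rank (u x))).
  by move=> x y /val_inj /enum_rank_inj /perm_inj.
exists (fun r => nat_of_ord (enum_rank (s r))).
exists (fun c => nat_of_ord (enum_rank (t c))).
split; try exact: inj_rank.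
- apply: lex_sorted_of_weight => [|r r']; first exact: inj_rank.
  apply: (max_perm_sorted (R := fun r => \sum_(c | A r c) 2 ^ enum_rank (t c))).
  move=> s'; have := max_st (s', t) isT; rewrite /W /=.
  by under eq_bigr do rewrite -big_distrr /=;
     under [in leqRHS]eq_bigr do rewrite -big_distrr /=.
- apply: lex_sorted_of_weight => [|c c']; first exact: inj_rank.
  apply: (max_perm_sorted (R := fun c => \sum_(r | A r c) 2 ^ enum_rank (s r))).
  move=> t'; have := max_st (s, t') isT; rewrite /W /=.
  rewrite (exchange_big_dep predT) //= [leqRHS](exchange_big_dep predT) //=.
  under eq_bigr do rewrite -big_distrl /= mulnC.
  by under [in leqRHS]eq_bigr do rewrite -big_distrl /= mulnC.
Qed.

(* The incidences of the path .., c_2, r_1, c_0, r_0, c_1, r_2, c_3, .. *)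
Definition path_incidence (i j : nat) : bool :=
  [|| i + j == 0, i == j.+1 | j == i.+1].

(** The entry at [(m, m)] joins the two ends of the path. *)
Definition cycle_incidence (m i j : nat) : bool :=
  path_incidence i j || (i == m) && (j == m).

(** Absent incidences are prescribed too, so the cycles are induced, pass through at least three
    rows and have distinct rows and columns. In an incidence matrix they are the special cycles. *)
Definition no_cycle (T1 T2 : finType) (A : T1 -> T2 -> bool) : Prop :=
  forall m (r : nat -> T1) (c : nat -> T2), 2 <= m ->
  ~ (forall i j, i <= m -> j <= m -> A (r i) (c j) = cycle_incidence m i j).

(** The last clause makes [c i.+2] the last column in which [r i] and [r i.+1] differ. *)
Definition lex_path (T1 T2 : finType) (A : T1 -> T2 -> bool)
    (q : T2 -> nat) (k : nat) (r : nat -> T1) (c : nat -> T2) : Prop :=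
  [/\ forall i j, i <= k -> j <= k -> A (r i) (c j) = path_incidence i j,
      forall i, i < k -> q (c i) < q (c i.+1) &
      forall i d, i.+1 < k -> q (c i.+2) < q d -> A (r i) d = A (r i.+1) d].

(** Of the rows [r k] and [r k.+1] only the first is incident to [c k.+1], so the ordering provides
    a later column [c'] as their last difference. *)
Lemma lex_path_extend (T1 T2 : finType) (A : T1 -> T2 -> bool)
    (p : T1 -> nat) (q : T2 -> nat) (k : nat) (r : nat -> T1) (c : nat -> T2) :
  lex_sorted A p q -> lex_path A q k.+1 r c -> p (r k) < p (r k.+1) ->
  exists c', [/\ q (c k.+1) < q c',
                 forall i, i <= k.+1 -> A (r i) c' = (i == k.+1) &
                 forall d, q c' < q d -> A (r k) d = A (r k.+1) d].
Proof.
move=> lexA [incA incrq agree] ltp.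
have [||c' [ltq nA A' agree']] := lexA _ _ (c k.+1) ltp.
- by rewrite incA // /path_incidence; lia.
- by rewrite incA // /path_incidence; lia.
exists c'; split=> //.
have monoq i : i <= k.+1 -> q (c i) <= q (c k.+1).
  move=> le_ik; rewrite -(subKn le_ik); elim: (k.+1 - i) => [|j IH].
    by rewrite subn0.
  apply: leq_trans IH; case: (ltnP j k.+1) => [lt_jk|le_kj].
    have -> : k.+1 - j = (k.+1 - j.+1).+1 by lia.
    by apply/ltnW/incrq; lia.
  by have -> : k.+1 - j.+1 = k.+1 - j by lia.
(* Beyond [c i.+2] the rows [r i] and [r i.+1] agree, so non-incidence with [c'] passes from [r k]
   to all earlier rows. *)
have down j : j <= k -> A (r (k - j)) c' = false.
  elim: j => [|j IH] le_jk; first by rewrite subn0 (negbTE nA).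
  have eq_kj : k - j = (k - j.+1).+1 by lia.
  rewrite (agree (k - j.+1)) -?eq_kj ?IH ?(ltnW le_jk) //; first by lia.
  by apply: leq_ltn_trans ltq; apply: monoq; lia.
move=> i; rewrite leq_eqVlt => /orP[/eqP ->|lt_ik]; first by rewrite eqxx A'.
by rewrite -(subKn (lt_ik : i <= k)) down ?leq_subr //; lia.
Qed.

(* A counterexample starts a path that can be prolonged forever: each row and
   each column is the last place where the previous two columns, or rows,
   differ, and it does not close the path into a cycle. *)
Lemma no_cycle_gamma_free (T1 T2 : finType) (A : T1 -> T2 -> bool)
    (p : T1 -> nat) (q : T2 -> nat) :
  lex_sorted A p q -> lex_sorted (fun c r => A r c) q p -> no_cycle A ->
  forall r0 r1 c0 c1, p r0 < p r1 -> q c0 < q c1 ->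
  A r0 c0 -> A r0 c1 -> A r1 c0 -> A r1 c1.
Proof.
move=> lexA lexB acyclic r0 r1 c0 c1 ltp ltq A00 A01 A10.
apply/negPn/negP => A11.
have long k : exists r c, lex_path A q k.+1 r c /\
                          lex_path (fun c r => A r c) p k.+1 c r.
  elim: k => [|k [r [c [[incA incq agq] [incB incp agp]]]]].
    exists (fun i => if i == 0 then r0 else r1).
    exists (fun i => if i == 0 then c0 else c1).
    by split; split=> // [[|[|i]] [|[|j]]|[|i]] //= *;
      rewrite ?A00 ?A01 ?A10 ?(negbTE A11).
  have [c' [ltq' incc' agc']] :=
    lex_path_extend lexA (And3 incA incq agq) (incp k (ltnSn k)).
  have [r' [ltp' incr' agr']] :=
    lex_path_extend lexB (And3 incB incp agp) (incq k (ltnSn k)).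
  pose rr i := if i == k.+2 then r' else r i.
  pose cc i := if i == k.+2 then c' else c i.
  have inc i j : i <= k.+2 -> j <= k.+2 -> (i == k.+2) && (j == k.+2) = false ->
      A (rr i) (cc j) = path_incidence i j.
    rewrite /rr /cc => le_i le_j.
    case: (eqVneq i k.+2) => [->|ne_i]; case: (eqVneq j k.+2) => [->|ne_j] //= _.
    - by rewrite incr' 1?ltn_neqAle ?ne_j // /path_incidence; lia.
    - by rewrite incc' 1?ltn_neqAle ?ne_i // /path_incidence; lia.
    - by rewrite incA // -ltnS ltn_neqAle ?ne_i ?ne_j.
  (* Incidence of the new row with the new column would close a cycle with [k.+3] rows. *)
  have [Arc|Arc] := boolP (A r' c').
    case: (acyclic k.+2 rr cc isT) => i j le_i le_j; rewrite /cycle_incidence.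
    case: (boolP ((i == k.+2) && (j == k.+2))) => [/andP[/eqP-> /eqP->]|/negbTE ne].
      by rewrite /rr /cc eqxx Arc orbT.
    by rewrite inc // orbF.
  have inc' i j : i <= k.+2 -> j <= k.+2 -> A (rr i) (cc j) = path_incidence i j.
    case: (boolP ((i == k.+2) && (j == k.+2))) => [/andP[/eqP-> /eqP->]|/negbTE ne].
      by rewrite /rr /cc eqxx (negbTE Arc) /path_incidence; lia.
    by move=> *; apply: inc.
  have old i : i < k.+2 -> (rr i = r i) * (cc i = c i).
    by move=> lt_i; rewrite /rr /cc (ltn_eqF lt_i).
  have new : (rr k.+2 = r') * (cc k.+2 = c') by rewrite /rr /cc eqxx.
  exists rr, cc; split; split=> [i j le_i le_j|i lt_i|i d lt_i]; rewrite ?inc' //.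
  - rewrite (old i) //; case: (ltngtP i k.+1) => [lt_ik||->]; last by rewrite new.
      by rewrite old // incq.
    by lia.
  - rewrite !(old i, old i.+1) ?(ltnW lt_i) //.
    case: (ltngtP i k) => [lt_ik||->]; last by rewrite new => /agc'.
      by rewrite old //; apply: agq.
    by lia.
  - by rewrite /path_incidence; lia.
  - rewrite (old i) //; case: (ltngtP i k.+1) => [lt_ik||->]; last by rewrite new.
      by rewrite old // incp.
    by lia.
  - rewrite !(old i, old i.+1) ?(ltnW lt_i) //.
    case: (ltngtP i k) => [lt_ik||->]; last by rewrite new => /agr'.
      by rewrite old //; apply: agp.
    by lia.
(* [p] strictly increases along the rows of the path, so a path of more than [\max_x p x] steps is
   impossible. *)
have [r [_ [_ [_ incr _]]]] := long (\max_x p x).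
have ge k : k <= (\max_x p x).+1 -> k <= p (r k).
  elim: k => // k IH lt_k.
  exact: leq_ltn_trans (IH (ltnW lt_k)) (incr _ lt_k).
by have := ge _ (leqnn _); rewrite ltnNge leq_bigmax.
Qed.

(** The hyperforest condition for a bare family of edges, since the induction passes to
    subfamilies. *)
Definition hereditary_leaf (n : nat) (E : {set {set 'I_n}}) : Prop :=
  forall E' : {set {set 'I_n}}, E' \subset E -> E' != set0 -> exists e, leaf E' e.

(** A leaf among the rows of a cycle shares each of its two columns with another row, so [g] would
    contain both columns; no second row of the cycle does. *)
Lemma hereditary_leaf_no_cycle (n : nat) (E : {set {set 'I_n}}) :
  hereditary_leaf E ->
  no_cycle (fun (r : {set 'I_n}) v => (r \in E) && (v \in r)).
Proof.
move=> leafE m r c le2m inc.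
pose S := [set r i | i : 'I_m.+1].
have Sr i : i <= m -> r i \in S.
  by move=> le_i; apply/imsetP; exists (inord i); rewrite ?inordK.
have incR i j : i <= m -> j <= m -> cycle_incidence m i j -> c j \in r i.
  by move=> le_i le_j; rewrite -inc // => /andP[].
have nincR i j : i <= m -> j <= m -> ~~ cycle_incidence m i j -> r i \in E ->
    c j \notin r i.
  by move=> le_i le_j; rewrite -inc // => + rE; rewrite rE.
have rE i : i <= m -> r i \in E.
  move=> le_i; have : cycle_incidence m i i.-1.
    by rewrite /cycle_incidence /path_incidence; lia.
  by rewrite -inc => [/andP[]| |]//; lia.
have [||e [/imsetP[i _ ->]]] := leafE S.
- by apply/subsetP => _ /imsetP[i _ ->]; rewrite rE // -ltnS.
- by apply/set0Pn; exists (r 0); apply: Sr.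
have le_i : i <= m by rewrite -ltnS.
(* [c a] and [c b] are the columns on [r i]; [r oa] and [r ob] are the other rows through them. *)
pose a := i.-1; pose b := if i == m :> nat then m else i.+1.
pose oa := if i == 0 :> nat then 1 else if i == 1 :> nat then 0 else i - 2.
pose ob := if i == m :> nat then m.-1 else if i == m.-1 :> nat then m else i.+2.
have le_a : a <= m by rewrite /a; lia.
have le_b : b <= m by rewrite /b; case: ifP; lia.
have le_oa : oa <= m by rewrite /oa; do 2?case: ifP; lia.
have le_ob : ob <= m by rewrite /ob; do 2?case: ifP; lia.
have inc_ia : c a \in r i.
  by apply: incR => //; rewrite /cycle_incidence /path_incidence /a; lia.
have inc_ib : c b \in r i.
  by apply: incR => //; rewrite /cycle_incidence /path_incidence /b; case: ifP; lia.
have inc_oa : c a \in r oa.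
  by apply: incR => //; rewrite /cycle_incidence /path_incidence /a /oa; do 2?case: ifP; lia.
have inc_ob : c b \in r ob.
  by apply: incR => //; rewrite /cycle_incidence /path_incidence /b /ob; do 2?case: ifP; lia.
have ne_oa : r oa != r i.
  apply: contraTneq inc_ib => <-; apply: nincR => //; last exact: rE.
  by rewrite /cycle_incidence /path_incidence /b /oa; do 3?case: ifP; lia.
have ne_ob : r ob != r i.
  apply: contraTneq inc_ia => <-; apply: nincR => //; last exact: rE.
  by rewrite /cycle_incidence /path_incidence /a /ob; do 2?case: ifP; lia.
case=> [SE|[g [/imsetP[j _ ->] ne_ji sub_g]]].
  by move: (Sr oa le_oa) ne_oa; rewrite SE inE => ->.
have le_j : j <= m by rewrite -ltnS.
have /subsetP/(_ (c a)) := sub_g _ (Sr oa le_oa) ne_oa.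
rewrite !inE inc_ia inc_oa => /(_ isT) /= inc_ja.
have /subsetP/(_ (c b)) := sub_g _ (Sr ob le_ob) ne_ob.
rewrite !inE inc_ib inc_ob => /(_ isT) /= inc_jb.
have : cycle_incidence m j a by rewrite -inc // rE.
have : cycle_incidence m j b by rewrite -inc // rE.
suff : nat_of_ord j <> i.
  by rewrite /cycle_incidence /path_incidence /a /b; case: ifP; lia.
by move=> eq_ji; move: ne_ji; rewrite eq_ji eqxx.
Qed.

(** Let [e] be the first edge in the row order. If [u] and [v] witness that [e :&: a] and [e :&: b]
    are incomparable, then [e] and one of [a], [b] form on these columns the pattern excluded by
    [no_cycle_gamma_free]. *)
Lemma hereditary_leaf_good_leaf (n : nat) (E : {set {set 'I_n}}) :
  hereditary_leaf E ->
  E != set0 ->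
  exists2 e, e \in E & forall a b, a \in E -> b \in E ->
    (e :&: a \subset e :&: b) || (e :&: b \subset e :&: a).
Proof.
move=> /hereditary_leaf_no_cycle acyclic /set0Pn[e0 e0E].
have [p [q [inj_p inj_q lexA lexB]]] :=
  doubly_lexical (fun (r : {set 'I_n}) v => (r \in E) && (v \in r)).
case: (@arg_minnP _ e0 (fun x => x \in E) p e0E) => e eE min_e.
exists e => // a b aE bE; apply/negPn/negP; rewrite negb_or => /andP[].
case/subsetPn => u; rewrite !inE => /andP[ue ua]; rewrite ue /= => ub.
case/subsetPn => v; rewrite !inE => /andP[ve vb]; rewrite ve /= => va.
have lt_p x w : x \in E -> w \in e -> w \notin x -> p e < p x.
  move=> xE we wx; rewrite ltn_neqAle min_e // andbT.
  by apply: contraNneq wx => /inj_p <-.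
have gamma := no_cycle_gamma_free lexA lexB acyclic.
case: (ltngtP (q u) (q v)) => [lt_uv|lt_vu|/inj_q eq_uv]; last by rewrite eq_uv vb in ub.
- have := gamma e a u v (lt_p _ v aE ve va) lt_uv.
  by rewrite eE aE ue ve ua (negbTE va) => /(_ isT isT isT).
- have := gamma e b v u (lt_p _ u bE ue ub) lt_vu.
  by rewrite eE bE ue ve vb (negbTE ub) => /(_ isT isT isT).
Qed.

(** * Exponents of powers of edge ideals *)

Definition upward_closed (n : nat) (M : 'X_{1..n} -> Prop) : Prop :=
  forall m m', M m -> M (m + m')%MM.

Definition hits (n : nat) (K : {set 'I_n}) (m : 'X_{1..n}) : Prop :=
  exists2 i, i \in K & (0 < m i)%N.

Lemma hits_upward (n : nat) (K : {set 'I_n}) : upward_closed (hits K).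
Proof.
by move=> m m' [i iK lt_m]; exists i => //; rewrite mnmDE ltn_addr.
Qed.

(** The exponents of (I(E)^s : x_W) + (K): [t] lists [s] edges, possibly repeated, whose product
    divides x^m x_W. *)
Definition power_monomials (n : nat) (E : {set {set 'I_n}}) (K W : {set 'I_n})
    (s : nat) (m : 'X_{1..n}) : Prop :=
  hits K m \/
  exists t : seq {set 'I_n}, [/\ size t = s, {subset t <= E} &
    forall v, count (fun a : {set 'I_n} => v \in a) t <= m v + (v \in W)].

Definition avoid (n : nat) (E : {set {set 'I_n}}) (z : 'I_n) :
    {set {set 'I_n}} :=
  [set a in E | z \notin a].

Lemma power_monomials_upward (n : nat) (E : {set {set 'I_n}})
    (K W : {set 'I_n}) (s : nat) :
  upward_closed (power_monomials E K W s).
Proof.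
move=> m m' [Km|[t [sz tE ct]]]; first by left; apply: hits_upward.
right; exists t; split=> // v; apply: leq_trans (ct v) _.
by rewrite mnmDE leq_add2r leq_addr.
Qed.

(** If x_z does not divide the monomial, no factor can contain [z], because [z] is not in [W]
    either. *)
Lemma power_monomials_adjoin (n : nat) (E : {set {set 'I_n}})
    (K W : {set 'I_n}) (s : nat) (z : 'I_n) (m : 'X_{1..n}) :
  z \notin W ->
  power_monomials E K W s m \/ 0 < m z <->
  power_monomials (avoid E z) (z |: K) W s m.
Proof.
move=> zW; split.
- case: (posnP (m z)) => [mz0|lt_m _]; last by left; exists z => //; rewrite setU11.
  case=> [[[i iK lt_m]|[t [sz tE ct]]]|//].
    by left; exists i => //; rewrite setU1r.
  right; exists t; split=> // a ta; rewrite inE tE //=.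
  have := ct z; rewrite mz0 (negbTE zW) leqn0 -leqn0 leqNgt -has_count.
  by apply: contraNN => za; apply/hasP; exists a.
- case=> [[i + lt_m]|[t [sz tE ct]]].
    by rewrite !inE => /orP[/eqP<-|iK]; [right|left; left; exists i].
  by left; right; exists t; split=> // a /tE; rewrite inE => /andP[].
Qed.

(** Moving one exponent of [z] from the monomial to [W] preserves the bound on the factors. *)
Lemma power_monomials_colon (n : nat) (E : {set {set 'I_n}})
    (K W : {set 'I_n}) (s : nat) (z : 'I_n) (m : 'X_{1..n}) :
  z \notin W -> z \notin K ->
  power_monomials E K W s (m + U_(z))%MM <->
  power_monomials E K (z |: W) s m.
Proof.
move=> zW zK.
have eq_exp v : (m + U_(z))%MM v + (v \in W) = m v + (v \in z |: W).
  rewrite mnmDE mnm1E inE in_set1 -addnA; congr (_ + _).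
  by rewrite eq_sym; case: eqP => // ->; rewrite (negbTE zW).
have eq_hits : hits K (m + U_(z))%MM <-> hits K m.
  split=> -[i iK]; rewrite ?mnmDE ?mnm1E => lt_m; exists i => //.
    by case: eqP iK lt_m => [<-|_ _]; rewrite ?(negbTE zK) // addn0.
  by rewrite mnmDE ltn_addr.
split=> -[/eq_hits|[t [sz tE ct]]]; try (by left); right; exists t; split=> // v.
  by rewrite -eq_exp.
by rewrite eq_exp.
Qed.

(* If the edge [e] is not a factor, remove the factor meeting [e] most: by the
   chain condition it contains every vertex of [e] lying on some factor. *)
Lemma power_monomials_good_leaf (n : nat) (E : {set {set 'I_n}})
    (K W e : {set 'I_n}) (s : nat) (m : 'X_{1..n}) :
  e \in E -> e \subset W ->
  (forall a b, a \in E -> b \in E ->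
     (e :&: a \subset e :&: b) || (e :&: b \subset e :&: a)) ->
  power_monomials E K W s.+1 m <-> power_monomials E K (W :\: e) s m.
Proof.
move=> eE eW chain; split=> -[Km|[t [sz tE ct]]]; try (by left); right.
- have [a ta max_a] : exists2 a, a \in t &
      forall b, b \in t -> e :&: b \subset e :&: a.
    have [a0 t0] : exists a0, a0 \in t.
      by case: t sz {tE ct} => // a0 t _; exists a0; rewrite mem_head.
    case: (@arg_maxnP _ a0 (fun a => a \in t) (fun a => #|e :&: a|) t0) => a ta max_a.
    exists a => // b tb; case/orP: (chain a b (tE a ta) (tE b tb)) => // sub_ab.
    have : e :&: a == e :&: b by rewrite eqEcard sub_ab; apply: max_a.
    by move/eqP <-.
  exists (rem a t); split; first by rewrite size_rem // sz.
    by move=> b /mem_rem /tE.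
  move=> v; rewrite count_rem ta /=; have := ct v; rewrite inE.
  case ve: (v \in e) => /=; last by lia.
  rewrite (subsetP eW _ ve) addn0; case va: (v \in a) => /=; first by lia.
  suff -> : count (fun b : {set 'I_n} => v \in b) t = 0 by [].
  apply/eqP; rewrite -leqn0 leqNgt -has_count; apply/hasP => -[b tb vb].
  by have /subsetP/(_ v) := max_a b tb; rewrite !inE ve vb va => /(_ isT).
- exists (e :: t); split; rewrite /= ?sz //.
    by move=> a; rewrite inE => /orP[/eqP->|/tE].
  move=> v; have := ct v; rewrite inE.
  by case ve: (v \in e) => /=; [rewrite (subsetP eW _ ve)|]; lia.
Qed.

(** Unlike in [edgewise_dominant], only vertices on edges need to be dominated; isolated ones are
    counted separately in [depth_bound]. Divided variables on edges must moreover be covered. *)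
Definition dominates (n : nat) (E F : {set {set 'I_n}}) (W : {set 'I_n}) : Prop :=
  [/\ F \subset E, W :&: cover E \subset cover F &
      forall v, v \in cover E -> [set v] \in E \/
      exists2 a, a \in E & exists w, [/\ v \in a, w \in a, w != v & w \in cover F]].

(* The invariant of the induction bounding below by [d] the depth of the ideal
   (I(E)^s + (K)) : W, where vertices outside of [K] and of all edges count as
   additional edges. *)
Definition depth_bound (n : nat) (E : {set {set 'I_n}}) (K W : {set 'I_n})
    (s d : nat) : Prop :=
  (d <= 1 /\ exists2 v, v \notin K & [set v] \notin E) \/
  forall F, dominates E F W -> d + s <= #|F| + #|~: (K :|: cover E)| + 1.

Lemma mem_coverP (n : nat) (E : {set {set 'I_n}}) (v : 'I_n) :
  reflect (exists2 a, a \in E & v \in a) (v \in cover E).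
Proof. exact: bigcupP. Qed.

Lemma avoid_sub (n : nat) (E : {set {set 'I_n}}) (z : 'I_n) : avoid E z \subset E.
Proof. by apply/subsetP => a; rewrite inE => /andP[]. Qed.

Lemma cover_sub (n : nat) (E F : {set {set 'I_n}}) :
  E \subset F -> cover E \subset cover F.
Proof.
move=> /subsetP sub; apply/subsetP => v /mem_coverP[a /sub aF va].
by apply/mem_coverP; exists a.
Qed.

(** A dominating [F'] of the smaller family is completed by one edge through each vertex of [N],
    that is, each vertex other than [z] which has lost all its edges. The vertices of [N] become
    isolated, so the count of isolated vertices grows by at least the number of added edges. *)
Lemma depth_bound_avoid (n : nat) (E : {set {set 'I_n}}) (K W e : {set 'I_n})
    (z : 'I_n) (s d : nat) :
  simple_edges E -> [disjoint K & cover E] -> z \notin W -> e \in E -> z \in e ->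
  [set z] \in E \/
    (exists w, [/\ w \in e, w != z & (w \in W) || (w \notin cover (avoid E z))]) ->
  depth_bound E K W s d -> depth_bound (avoid E z) (z |: K) W s d.
Proof.
move=> simpleE disjK zW eE ze cond.
have coverK v : v \in cover E -> v \notin K.
  by move=> vE; apply: contraTN vE => vK; rewrite (disjointFr disjK vK).
have ez : z \in cover E by apply/mem_coverP; exists e.
case=> [[le_d1 [v vK vE]]|bound]; [left; split=> //|right].
(* If [[set z]] is an edge, then [v] differs from [z] and still serves; otherwise [w] does, since an
   edge [[set w]] would be contained in [e]. *)
- case: cond => [zE|[w [we wz _]]].
    exists v; first by rewrite !inE negb_or vK andbT; apply: contraNneq vE => ->.
    by rewrite inE negb_and vE.
  exists w; last first.
    rewrite inE negb_and negbK; apply/orP; left; apply/negP => wE.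
    have eq_we : [set w] = e by apply: simpleE => //; rewrite sub1set.
    by move: ze; rewrite -eq_we inE eq_sym (negbTE wz).
  by rewrite !inE negb_or wz coverK //; apply/mem_coverP; exists e.
move=> F' [F'E' coverW dom].
set E' := avoid E z in F'E' coverW dom cond *.
have E'E : E' \subset E := avoid_sub E z.
pose N := (cover E :\: cover E') :\ z.
pose phi u := odflt set0 [pick a in E | u \in a].
have phiP u : u \in cover E -> (phi u \in E) * (u \in phi u).
  rewrite /phi; case: pickP => [a /andP[aE ua]//|none] /mem_coverP[a aE ua].
  by have := none a; rewrite aE ua.
pose F := F' :|: phi @: N.
have coverN u : u \in N -> u \in cover F.
  rewrite 3!inE => uN; have /andP[_ /andP[_ /phiP[phiE uphi]]] := uN.
  apply/mem_coverP; exists (phi u) => //.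
  by rewrite inE imset_f ?orbT // 3!inE.
have coverF' u : u \in cover F' -> u \in cover F.
  by apply/subsetP/cover_sub/subsetUl.
have coverWF u : u \in W -> u \in cover E -> u \in cover F.
  move=> uW uE; case: (boolP (u \in cover E')) => uE'.
    by apply/coverF'/(subsetP coverW); rewrite inE uW.
  by apply: coverN; rewrite !inE uE uE' !andbT; apply: contraTneq uW => ->.
have domF : dominates E F W.
  split.
  - rewrite subUset (subset_trans F'E' E'E) /=; apply/subsetP => _ /imsetP[u uN ->].
    by move: uN; rewrite !inE => /andP[_ /andP[_ /phiP[]]].
  - by apply/subsetP => u; rewrite inE => /andP[]; apply: coverWF.
  (* The vertex [z] is dominated through its neighbour [w], which [F] covers because it is in [W] or
     in [N]. *)
  move=> v vE; case: (eqVneq v z) => [->|vz].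
    case: cond => [|[w [we wz wN]]]; [by left|right; exists e => //; exists w].
    have wE : w \in cover E by apply/mem_coverP; exists e.
    split=> //; case/orP: wN => [wW|wE']; first exact: coverWF.
    by apply: coverN; rewrite !inE wz wE'.
  case: (boolP (v \in cover E')) => vE'.
    case: (dom v vE') => [vE1|[a aE' [w [va wa wv wF']]]].
      by left; apply: (subsetP E'E).
    right; exists a; first exact: (subsetP E'E).
    by exists w; split=> //; apply: coverF'.
  have [phiE vphi] := phiP v vE.
  case: (boolP (phi v \subset [set v])) => [sub_v|/subsetPn[w wphi]].
    left; suff <- : phi v = [set v] by [].
    by apply/eqP; rewrite eqEsubset sub_v sub1set.
  rewrite inE => wv; right; exists (phi v) => //; exists w; split=> //.
  apply/mem_coverP; exists (phi v) => //; rewrite inE imset_f ?orbT //.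
  by rewrite !inE vz vE'.
apply: leq_trans (bound F domF) _; rewrite leq_add2r.
have leF : #|F| <= #|F'| + #|N|.
  by rewrite (leq_trans (leq_card_setU _ _)) // leq_add2l leq_imset_card.
apply: leq_trans (leq_add leF (leqnn _)) _; rewrite -addnA leq_add2l.
rewrite -cardsUI [X in _ + X](_ : _ = 0) ?addn0.
  apply/subset_leq_card/subsetP => u; rewrite !inE.
  case/orP => [/and3P[uz uE' uE]|]; first by rewrite (negbTE uz) (negbTE uE') orbF coverK.
  rewrite !negb_or => /andP[-> uE]; rewrite andbT; apply/andP; split.
    by apply: contraNneq uE => ->.
  by apply: contraNN uE; apply/subsetP/cover_sub.
apply/eqP; rewrite cards_eq0; apply/eqP/setP => u; rewrite !inE.
by case: (u \in cover E); rewrite ?orbT ?andbF.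
Qed.

(** Every other edge meets [e] inside the largest intersection [e :&: a], and simplicity leaves a
    vertex of [e] outside [a]. *)
Lemma good_leaf_free_vertex (n : nat) (E : {set {set 'I_n}}) (e : {set 'I_n}) :
  simple_edges E -> set0 \notin E -> e \in E ->
  (forall a b, a \in E -> b \in E ->
     (e :&: a \subset e :&: b) || (e :&: b \subset e :&: a)) ->
  exists2 y, y \in e & forall a, a \in E -> y \in a -> a = e.
Proof.
move=> simpleE E0 eE chain.
case: (pickP (fun a => (a \in E) && (a != e))) => [a0 a0E|none].
  case: (@arg_maxnP _ a0 (fun a => (a \in E) && (a != e)) (fun a => #|e :&: a|) a0E).
  move=> a /andP[aE ne_a] max_a.
  have /subsetPn[y ye ya] : ~~ (e \subset a).
    by apply: contraNN ne_a => /(simpleE e a eE aE) ->.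
  exists y => // b bE yb; apply/eqP; apply: contraNT ya => ne_b.
  have sub_ba : e :&: b \subset e :&: a.
    case/orP: (chain a b aE bE) => // sub_ab.
    have : e :&: a == e :&: b by rewrite eqEcard sub_ab; apply: max_a; rewrite bE.
    by move/eqP <-.
  by have /subsetP/(_ y) := sub_ba; rewrite !inE ye yb => /(_ isT).
have /set0Pn[y ye] : e != set0 by apply: contraNneq E0 => <-.
exists y => // a aE _; apply/eqP; apply/negPn/negP => ne_a.
by have := none a; rewrite aE ne_a.
Qed.

(** Adding [e] to a dominating set covers the part of [W] in [e]; it costs at most one edge, offset
    by the drop of the exponent. *)
Lemma depth_bound_good_leaf (n : nat) (E : {set {set 'I_n}}) (K W e : {set 'I_n})
    (s d : nat) :
  e \in E -> depth_bound E K W s.+1 d -> depth_bound E K (W :\: e) s d.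
Proof.
move=> eE [small|bound]; [by left|right=> F [FE coverW dom]].
have coverF v : v \in cover F -> v \in cover (e |: F).
  by apply/subsetP/cover_sub/subsetUr.
have /bound : dominates E (e |: F) W.
  split.
  - by rewrite subUset sub1set eE.
  - apply/subsetP => v; rewrite inE => /andP[vW vE].
    case: (boolP (v \in e)) => ve.
      by apply/mem_coverP; exists e => //; apply: setU11.
    by apply/coverF/(subsetP coverW); rewrite !inE ve vW.
  - move=> v /dom[|[a aE [w [va wa wv wF]]]]; [by left|right].
    by exists a => //; exists w; split=> //; apply: coverF.
rewrite addnS => /leq_trans le_d; rewrite -ltnS; apply: le_d.
by rewrite -!addSn !leq_add2r -add1n cardsU1 leq_add2r leq_b1.
Qed.

Lemma depth_bound_extend (n : nat) (E : {set {set 'I_n}}) (K W : {set 'I_n})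
    (z : 'I_n) (s d : nat) :
  depth_bound E K W s d -> depth_bound E K (z |: W) s d.
Proof.
move=> [small|bound]; [by left|right=> F [FE coverW dom]]; apply: bound; split=> //.
by apply: subset_trans coverW; apply/setSI/subsetUr.
Qed.

(** * Weakly regular sequences *)

Import GRing.Theory.
Local Open Scope ring_scope.

Definition is_ideal (A : comNzRingType) (J : A -> Prop) : Prop :=
  [/\ J 0, forall p q, J p -> J q -> J (p + q) & forall r p, J p -> J (r * p)].

(** The ideal J + (f_0, ..., f_(i-1)), built by adjoining one element at a time so that inductions
    handle a single coefficient. *)
Fixpoint adjoin_first (A : comNzRingType) (J : A -> Prop) (f : nat -> A)
    (i : nat) : A -> Prop :=
  if i is j.+1 then fun p => exists q, adjoin_first J f j (p - q * f j) else J.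

(** The quotient by all the elements may be zero here. *)
Definition weakly_regular (A : comNzRingType) (J : A -> Prop) (f : nat -> A)
    (d : nat) : Prop :=
  forall i p, (i < d)%N -> adjoin_first J f i (f i * p) -> adjoin_first J f i p.

Definition colon (A : comNzRingType) (J : A -> Prop) (z p : A) : Prop :=
  J (z * p).

Definition adjoin1 (A : comNzRingType) (J : A -> Prop) (z p : A) : Prop :=
  exists r, J (p - z * r).

Lemma adjoin_first_ideal (A : comNzRingType) (J : A -> Prop) (f : nat -> A) i :
  is_ideal J -> is_ideal (adjoin_first J f i).
Proof.
move=> idJ; elim: i => //= i [J0 JD JM]; split.
- by exists 0; rewrite mul0r subr0.
- move=> p q [a Ja] [b Jb]; exists (a + b).
  by have := JD _ _ Ja Jb; congr adjoin_first; ring.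
- move=> r p [a Ja]; exists (r * a).
  by have := JM r _ Ja; congr adjoin_first; ring.
Qed.

Lemma adjoin1_ideal (A : comNzRingType) (J : A -> Prop) z :
  is_ideal J -> is_ideal (adjoin1 J z).
Proof.
move=> [J0 JD JM]; split.
- by exists 0; rewrite mulr0 subr0.
- move=> p q [a Ja] [b Jb]; exists (a + b).
  by have := JD _ _ Ja Jb; congr J; ring.
- by move=> r p [a Ja]; exists (r * a); have := JM r _ Ja; congr J; ring.
Qed.

Lemma ideal_sub (A : comNzRingType) (J : A -> Prop) p q :
  is_ideal J -> J p -> J q -> J (p - q).
Proof. by move=> [J0 JD JM] Jp Jq; rewrite -mulN1r; apply: JD => //; apply: JM. Qed.

Lemma adjoin_first_sub (A : comNzRingType) (J J' : A -> Prop) (f : nat -> A) :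
  (forall p, J p -> J' p) ->
  forall i p, adjoin_first J f i p -> adjoin_first J' f i p.
Proof.
by move=> sub; elim=> //= i IH p [q Jq]; exists q; apply: IH.
Qed.

Lemma weakly_regular_ext (A : comNzRingType) (J J' : A -> Prop) (f : nat -> A) d :
  (forall p, J p <-> J' p) -> weakly_regular J f d -> weakly_regular J' f d.
Proof.
move=> eqJ reg i p lt_i.
move/(adjoin_first_sub (fun q => (eqJ q).2))/(reg i p lt_i).
exact: (adjoin_first_sub (fun q => (eqJ q).1)).
Qed.

Lemma adjoin_first_colon (A : comNzRingType) (J : A -> Prop) z (f : nat -> A) i p :
  adjoin_first (colon J z) f i p -> adjoin_first J f i (z * p).
Proof.
elim: i p => //= i IH p [q /IH Jq]; exists (z * q).
by move: Jq; congr adjoin_first; ring.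
Qed.

Lemma adjoin_first_adjoin1 (A : comNzRingType) (J : A -> Prop) z (f : nat -> A) i p :
  adjoin_first (adjoin1 J z) f i p -> exists r, adjoin_first J f i (p - z * r).
Proof.
elim: i p => //= i IH p [q /IH[r Jr]]; exists r, q.
by move: Jr; congr adjoin_first; ring.
Qed.

Lemma adjoin1_adjoin_first (A : comNzRingType) (J : A -> Prop) z (f : nat -> A) i p :
  is_ideal J -> adjoin_first J f i p -> adjoin_first (adjoin1 J z) f i p.
Proof.
move=> [J0 JD JM]; apply: adjoin_first_sub => q Jq.
by exists 0; rewrite mulr0 subr0.
Qed.

Lemma adjoin1_adjoin_first_gen (A : comNzRingType) (J : A -> Prop) z
    (f : nat -> A) i r :
  is_ideal J -> adjoin_first (adjoin1 J z) f i (z * r).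
Proof.
move=> idJ; have [J0 JD JM] := idJ.
have [] : is_ideal (adjoin_first (adjoin1 J z) f i).
  exact/adjoin_first_ideal/adjoin1_ideal.
elim: i => [|i IH] K0 _ _ /=; first by exists r; rewrite subrr.
have [L0 LD LM] := adjoin_first_ideal f i (adjoin1_ideal z idJ).
by exists 0; rewrite mul0r subr0; apply: IH.
Qed.

(* Exactness of [0 -> A/(J : z) -> A/J -> A/(J, z) -> 0] is preserved modulo
   the first [i] elements, as these are regular on the quotient. *)
Lemma adjoin_first_colonP (A : comNzRingType) (J : A -> Prop) z (f : nat -> A) i p :
  is_ideal J -> weakly_regular (adjoin1 J z) f i ->
  adjoin_first J f i (z * p) -> adjoin_first (colon J z) f i p.
Proof.
move=> idJ; elim: i p => //= i IH p reg [q Jq].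
have idJz := adjoin_first_ideal f i (adjoin1_ideal z idJ).
(* Modulo [z] the relation reads f_i q = 0, so [q] is a multiple z r there, and [p - r * f i]
   satisfies the induction hypothesis. *)
have : adjoin_first (adjoin1 J z) f i (f i * q).
  have := ideal_sub idJz (adjoin1_adjoin_first_gen z f i p idJ)
                         (adjoin1_adjoin_first z idJ Jq).
  by congr adjoin_first; ring.
move/(reg i q (ltnSn i))/adjoin_first_adjoin1 => [r Jr].
exists r; apply: IH => [j u lt_j|]; first exact/reg/ltnW.
have [_ JD JM] := adjoin_first_ideal f i idJ.
by have := JD _ _ Jq (JM (f i) _ Jr); congr adjoin_first; ring.
Qed.

(** Regularity modulo [z] gives p = z r modulo J + (f_0, ..., f_(i-1)); then f_i r vanishes in the
    corresponding quotient for the colon ideal, so [r] does too, and z r returns to the ideal. *)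
Lemma weakly_regular_exact (A : comNzRingType) (J : A -> Prop) z (f : nat -> A) d :
  is_ideal J -> weakly_regular (colon J z) f d ->
  weakly_regular (adjoin1 J z) f d -> weakly_regular J f d.
Proof.
move=> idJ regc rega i p lt_i Jfp.
have [_ JD JM] := adjoin_first_ideal f i idJ.
have [r Jr] : exists r, adjoin_first J f i (p - z * r).
  exact/adjoin_first_adjoin1/rega/adjoin1_adjoin_first.
suff /adjoin_first_colon Jzr : adjoin_first (colon J z) f i r.
  by have := JD _ _ Jr Jzr; congr adjoin_first; ring.
apply: regc => //; apply: adjoin_first_colonP => // [j u lt_j|].
  by apply: rega; apply: ltn_trans lt_i.
have := ideal_sub (adjoin_first_ideal f i idJ) Jfp (JM (f i) _ Jr).
by congr adjoin_first; ring.
Qed.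

Lemma adjoin_first_base (A : comNzRingType) (J : A -> Prop) (f : nat -> A) i p :
  J p -> adjoin_first J f i p.
Proof.
by move=> Jp; elim: i => //= i IH; exists 0; rewrite mul0r subr0.
Qed.

Lemma adjoin_first_mem (A : comNzRingType) (J : A -> Prop) (f : nat -> A) i j :
  is_ideal J -> (j < i)%N -> adjoin_first J f i (f j).
Proof.
move=> [J0 _ _]; elim: i => //= i IH; rewrite ltnS leq_eqVlt => /orP[/eqP->|/IH Jf].
  by exists 1; rewrite mul1r subrr; apply: adjoin_first_base.
by exists 0; rewrite mul0r subr0.
Qed.

Lemma adjoin_firstE (A : comNzRingType) (J : A -> Prop) (f : nat -> A) i p :
  is_ideal J ->
  adjoin_first J f i p <-> ideal_adjoin J (mkseq f i) p.
Proof.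
move=> idJ; split.
- elim: i p => /= [p Jp|i IH p [q /IH[s [sJ eq_p]]]].
    exists [:: (1, p)]; split=> [c|]; rewrite ?inE ?big_seq1 ?mul1r //.
    by move=> /eqP ->; left.
  exists ((q, f i) :: s); split=> [c|]; last by rewrite big_cons -eq_p addrC subrK.
  rewrite mkseqS mem_rcons !inE => /orP[/eqP ->|/sJ[Jc|fc]]; first by right; rewrite eqxx.
    by left.
  by right; rewrite fc orbT.
- move=> [s [sJ ->]]; elim: s sJ => [|c s IH] sJ.
    by rewrite big_nil; case: (adjoin_first_ideal f i idJ).
  have [J0 JD JM] := adjoin_first_ideal f i idJ.
  rewrite big_cons; apply: JD; last by apply: IH => a sa; apply: sJ; rewrite inE sa orbT.
  apply: JM; have [] := sJ c (mem_head _ _); first exact: adjoin_first_base.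
  by case/mapP=> j; rewrite mem_iota => /= lt_j ->; apply: adjoin_first_mem.
Qed.

Lemma weakly_regular_all (A : comNzRingType) (J : A -> Prop) (f : nat -> A) d :
  (forall p, J p) -> weakly_regular J f d.
Proof. by move=> Jall i p _ _; apply: adjoin_first_base. Qed.

(** * Monomial ideals *)

Definition monomial_ideal (k : fieldType) (n : nat) (M : 'X_{1..n} -> Prop)
    (p : {mpoly k[n]}) : Prop :=
  forall m, m \in msupp p -> M m.

Lemma monomial_ideal_ideal (k : fieldType) (n : nat) (M : 'X_{1..n} -> Prop) :
  upward_closed M -> is_ideal (monomial_ideal (k := k) M).
Proof.
move=> upM; split.
- by move=> m; rewrite msupp0.
- by move=> p q Mp Mq m /msuppD_le; rewrite mem_cat => /orP[/Mp|/Mq].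
- by move=> r p Mp m /msuppM_le /allpairsP[[a b] /= [_ /Mp Mb ->]]; rewrite addmC; apply: upM.
Qed.

Lemma ideal_sum (A : comNzRingType) (J : A -> Prop) (I : eqType) (s : seq I)
    (P : pred I) (F : I -> A) :
  is_ideal J -> (forall i, i \in s -> P i -> J (F i)) -> J (\sum_(i <- s | P i) F i).
Proof.
move=> [J0 JD _] JF; rewrite big_seq_cond.
by apply: (big_ind J) => // i /andP[]; apply: JF.
Qed.

Lemma monomial_ideal_term (k : fieldType) (n : nat) (M : 'X_{1..n} -> Prop)
    (c : k) (m : 'X_{1..n}) :
  M m -> monomial_ideal M (c *: 'X_[m]).
Proof. by move=> Mm m' /msuppZ_le; rewrite msuppX inE => /eqP ->. Qed.

Lemma monomial_ideal_colon (k : fieldType) (n : nat) (M : 'X_{1..n} -> Prop)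
    (i : 'I_n) (p : {mpoly k[n]}) :
  colon (monomial_ideal M) 'X_i p <-> monomial_ideal (fun m => M (m + U_(i))%MM) p.
Proof.
rewrite /colon mulrC; split=> Mp m.
- by move=> pm; rewrite addmC; apply: Mp; rewrite mcoeff_msupp mcoeffMX -mcoeff_msupp.
- by rewrite (perm_mem (msuppMX _ _)) => /mapP[m' /Mp + ->]; rewrite addmC.
Qed.

Lemma monomial_ideal_adjoin1 (k : fieldType) (n : nat) (M : 'X_{1..n} -> Prop)
    (i : 'I_n) (p : {mpoly k[n]}) :
  upward_closed M ->
  adjoin1 (monomial_ideal M) 'X_i p <->
  monomial_ideal (fun m => M m \/ (0 < m i)%N) p.
Proof.
move=> upM; split=> [[r Mr] m pm|Mp].
  case: (boolP (m \in msupp (p - 'X_i * r))) => [/Mr|]; first by left.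
  rewrite -mcoeff_eq0 mcoeffB subr_eq0 => /eqP eq_c; right.
  move: pm; rewrite mcoeff_msupp eq_c -mcoeff_msupp mulrC.
  by rewrite (perm_mem (msuppMX _ _)) => /mapP[m' _ ->]; rewrite mnmDE mnm1E eqxx.
(* The terms of [p] divisible by X_i, each divided by it. *)
exists (\sum_(m <- msupp p | (0 < m i)%N) p@_m *: 'X_[m - U_(i)]).
rewrite mulr_sumr {1}[p]mpolyE (bigID (fun m : 'X_{1..n} => (0 < m i)%N)) /=.
rewrite (eq_bigr (fun m : 'X_{1..n} => 'X_i * (p@_m *: 'X_[m - U_(i)]))); last first.
  move=> m lt_m; rewrite -scalerAr -mpolyXD; congr (_ *: 'X_[_]).
  by apply/mnmP => j; rewrite mnmDE mnmBE mnm1E; case: eqP => [<-|_]; lia.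
rewrite addrAC subrr add0r.
apply: ideal_sum => [|m pm nlt_m]; first exact: monomial_ideal_ideal.
by apply: monomial_ideal_term; have [//|lt_m] := Mp m pm; rewrite lt_m in nlt_m.
Qed.

(** * Homogeneous ideals *)

Definition homogeneous_ideal (k : fieldType) (n : nat)
    (J : {mpoly k[n]} -> Prop) : Prop :=
  forall d p, J p -> J (pihomog mdeg d p).

Lemma monomial_ideal_homogeneous (k : fieldType) (n : nat)
    (M : 'X_{1..n} -> Prop) :
  upward_closed M -> homogeneous_ideal (monomial_ideal (k := k) M).
Proof.
move=> upM d p Mp; rewrite pihomogE.
apply: ideal_sum => [|m pm _]; first exact: monomial_ideal_ideal.
by apply: monomial_ideal_term; apply: Mp.
Qed.

Lemma pihomogM (k : fieldType) (n b d : nat) (q f : {mpoly k[n]}) :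
  f \is b.-homog for mdeg ->
  pihomog mdeg d (q * f) = if (b <= d)%N then pihomog mdeg (d - b) q * f else 0.
Proof.
(* [l] bounds the degrees in [q] and also exceeds [d], so that [d - b] is a valid index of the
   decomposition. *)
move=> hf; pose l := maxn (msize q) d.+1.
have term (e : nat) : pihomog mdeg d (pihomog mdeg e q * f) =
    if (e + b == d)%N then pihomog mdeg e q * f else 0.
  have he : pihomog mdeg e q * f \is (e + b).-homog for mdeg.
    by apply: dhomogM => //; apply: pihomogP.
  by case: eqVneq he => [-> /pihomog_dE|ne he] //; rewrite (pihomog_ne0 _ he).
rewrite {1}[q](pihomog_partitionE (mf := mdeg) (k := l)); last exact: leq_maxl.
rewrite mulr_suml linear_sum /=; under eq_bigr do rewrite term.
rewrite -big_mkcond /=.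
case: leqP => [le_bd|lt_db]; last by rewrite big_pred0 // => e; apply/negbTE; lia.
have lt_l : (d - b < l)%N by rewrite /l; lia.
rewrite (big_pred1 (Ordinal lt_l)) // => e /=.
by rewrite -(inj_eq val_inj) /=; lia.
Qed.

Lemma adjoin_first_homogeneous (k : fieldType) (n : nat)
    (J : {mpoly k[n]} -> Prop) (f : nat -> {mpoly k[n]}) (a : nat -> nat) i :
  is_ideal J -> homogeneous_ideal J ->
  (forall j, f j \is (a j).-homog for mdeg) ->
  homogeneous_ideal (adjoin_first J f i).
Proof.
move=> idJ homJ homf; elim: i => //= i IH d p [q /(IH d)].
rewrite pihomogB (pihomogM _ _ (homf i)); case: ifP => _ Jq.
  by exists (pihomog mdeg (d - a i) q).
by exists 0; rewrite mul0r.
Qed.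

(* Iterating the hypothesis puts [p] in [J + (X_i ^ N)] for all [N], hence the
   homogeneous components of [p] in [J]. *)
Lemma homogeneous_nzd (k : fieldType) (n : nat) (J : {mpoly k[n]} -> Prop)
    (f : {mpoly k[n]}) (i : 'I_n) :
  is_ideal J -> homogeneous_ideal J ->
  (forall p, J (f * p) -> exists r, J (p - 'X_i * r) /\ J (f * r)) ->
  forall p, J (f * p) -> J p.
Proof.
move=> idJ homJ step p Jfp; have [J0 JD JM] := idJ.
have [r [Jr _]] : exists r, J (p - 'X_i ^+ msize p * r) /\ J (f * r).
  elim: (msize p) => [|N [r [Jr Jfr]]].
    by exists p; rewrite expr0 mul1r subrr.
  have [r' [Jr' Jfr']] := step r Jfr; exists r'; split=> //.
  have := JD _ _ Jr (JM ('X_i ^+ N) _ Jr').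
  by congr J; rewrite exprS; ring.
rewrite [p](pihomog_partitionE (mf := mdeg) (k := msize p)) //.
apply: ideal_sum => // d _ _.
have homX : ('X_i ^+ msize p : {mpoly k[n]}) \is (msize p).-homog for mdeg.
  rewrite -{2}[msize p]mul1n; apply: dhomogMn.
  by rewrite dhomogX /= mdeg1.
(* All multiples of X_i^(msize p) have zero component in the degrees [d < msize p]. *)
have := homJ d _ Jr; rewrite pihomogB [_ * r]mulrC (pihomogM _ _ homX).
by rewrite leqNgt ltn_ord subr0.
Qed.

(** * Elementary symmetric polynomials modulo sets of variables *)

Lemma prod_vertices (k : fieldType) (n : nat) (e : {set 'I_n}) :
  \prod_(i in e) 'X_i = 'X_[mesym1 e] :> {mpoly k[n]}.
Proof.
rewrite mpolyXE_id big_mkcond /=; apply: eq_bigr => i _.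
by rewrite mnmE; case: ifP.
Qed.

(** The index is shifted to skip e_0 = 1. *)
Definition elem_sym (k : fieldType) (n i : nat) : {mpoly k[n]} := mesym n k i.+1.

(** The complement of [K] has [m.+1] elements, so it gives the only squarefree monomial of that
    degree avoiding [K]. *)
Lemma elem_sym_monomial (k : fieldType) (n : nat) (K : {set 'I_n}) (m : nat) :
  (#|K| + m.+1 = n)%N ->
  monomial_ideal (hits K) (elem_sym k n m - \prod_(i <- enum (~: K)) 'X_i).
Proof.
move=> cardK; have cardC : #|~: K| = m.+1.
  by apply/eqP; rewrite -(eqn_add2l #|K|) cardsC card_ord cardK.
rewrite /elem_sym mesymE (bigD1 (~: K)) /=; last by rewrite cardC.
rewrite -prod_vertices big_enum addrAC subrr add0r.
apply: ideal_sum => [|h _ /andP[/eqP card_h ne_h]].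
  exact/monomial_ideal_ideal/hits_upward.
move=> u; rewrite msuppX inE => /eqP ->.
have /subsetPn[i ih] : ~~ (h \subset ~: K).
  by apply: contraNN ne_h => sub_h; rewrite eqEcard sub_h card_h cardC leqnn.
by rewrite inE negbK => iK; exists i => //; rewrite mnmE ih.
Qed.

Lemma elem_sym_regular (k : fieldType) (n : nat) (K : {set 'I_n}) (d : nat) :
  (#|K| + d <= n)%N -> weakly_regular (monomial_ideal (hits K)) (elem_sym k n) d.
Proof.
suff main m (K' : {set 'I_n}) : (#|K'| + m = n)%N ->
    weakly_regular (monomial_ideal (hits K')) (elem_sym k n) m.
  move=> le_n i p lt_i; apply: (main (n - #|K|)%N); lia.
elim: m K' => {K d} [|m IH] K cardK i p; first by [].
pose J := monomial_ideal (k := k) (hits K).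
have idJ : is_ideal J by apply/monomial_ideal_ideal/hits_upward.
have regx x : x \notin K -> weakly_regular (adjoin1 J 'X_x) (elem_sym k n) m.
  move=> xK; apply: (@weakly_regular_ext _ (monomial_ideal (hits (x |: K)))).
    move=> q; rewrite /J monomial_ideal_adjoin1; last exact: hits_upward.
    split=> Mq u /Mq.
      by case=> y; rewrite !inE => /orP[/eqP -> |yK] lt_u; [right|left; exists y].
    by case=> [[y yK lt_u]|lt_u]; [exists y|exists x]; rewrite ?inE ?eqxx ?yK ?orbT.
  by apply: IH; rewrite cardsU1 xK; lia.
(* Since (K) : x = (K), [adjoin_first_colonP] cancels [x] modulo the first [j] elements. *)
have nzdx x j q : x \notin K -> (j <= m)%N ->
    adjoin_first J (elem_sym k n) j ('X_x * q) -> adjoin_first J (elem_sym k n) j q.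
  move=> xK le_j Jxq.
  apply: (@adjoin_first_sub _ (colon J 'X_x)).
    move=> r; rewrite /J monomial_ideal_colon => Mr u /Mr[y yK].
    rewrite mnmDE mnm1E; case: eqP xK => [->|_ _]; first by rewrite yK.
    by rewrite addn0; exists y.
  apply: adjoin_first_colonP => // l r lt_l; apply: regx => //.
  exact: leq_trans lt_l le_j.
(* The last element is, modulo (K), the product of the remaining variables, which are cancelled one
   by one. *)
rewrite ltnS leq_eqVlt => /orP[/eqP ->|lt_im].
  have idJm := adjoin_first_ideal (elem_sym k n) m idJ; have [_ _ JM] := idJm.
  move=> Jep.
  have : adjoin_first J (elem_sym k n) m ((\prod_(x <- enum (~: K)) 'X_x) * p).
    have /(adjoin_first_base (elem_sym k n) m)/(JM p) := elem_sym_monomial (k := k) cardK.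
    by move/(ideal_sub idJm Jep); congr adjoin_first; ring.
  have : {in enum (~: K), forall x, x \notin K} by move=> x; rewrite mem_enum inE.
  elim: (enum _) => [|x s IHs] sK; first by rewrite big_nil mul1r.
  rewrite big_cons -mulrA => /nzdx Js; apply: IHs => [y sy|].
    by apply: sK; rewrite inE sy orbT.
  by apply: Js => //; apply: sK; rewrite mem_head.
(* For the earlier elements, regularity modulo one more variable [x] makes [p] a multiple of [x],
   and homogeneity allows iterating this. *)
have [x xK] : exists x, x \in ~: K.
  apply/card_gt0P; rewrite -(ltn_add2l #|K|) cardsC card_ord addn0; lia.
rewrite inE in xK.
have idJi := adjoin_first_ideal (elem_sym k n) i idJ; have [_ JD JM] := idJi.
apply: (homogeneous_nzd (i := x)) => //.
  apply: (adjoin_first_homogeneous (a := S)) => //.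
    by apply: monomial_ideal_homogeneous; apply: hits_upward.
  by move=> j; apply: dhomog_mesym.
move=> q Jeq.
have [r Jr] : exists r, adjoin_first J (elem_sym k n) i (q - 'X_x * r).
  by apply/adjoin_first_adjoin1/(regx x xK) => //; apply: adjoin1_adjoin_first.
exists r; split=> //; apply: (nzdx x) => //; first exact: ltnW.
have := ideal_sub idJi Jeq (JM (elem_sym k n i) _ Jr).
by congr adjoin_first; ring.
Qed.

Lemma monomial_ideal_ext (k : fieldType) (n : nat) (M M' : 'X_{1..n} -> Prop)
    (f : nat -> {mpoly k[n]}) d :
  (forall m, M m <-> M' m) ->
  weakly_regular (monomial_ideal M) f d -> weakly_regular (monomial_ideal M') f d.
Proof.
by move=> eqM; apply: weakly_regular_ext => p; split=> Mp m /Mp /eqM.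
Qed.

(** * From ideals to exponents, and from weak regularity to regular sequences *)

Lemma ideal_gen_ideal (A : comNzRingType) (S : A -> Prop) : is_ideal (ideal_gen S).
Proof.
split.
- by exists [::]; rewrite big_nil.
- move=> _ _ [s [sS ->]] [t [tS ->]]; exists (s ++ t); rewrite big_cat; split=> // c.
  by rewrite mem_cat => /orP[/sS|/tS].
- move=> r _ [s [sS ->]]; exists [seq (r * c.1, c.2) | c <- s]; split.
    by move=> _ /mapP[c /sS Sc ->].
  by rewrite big_map mulr_sumr; apply: eq_bigr => c _; rewrite mulrA.
Qed.

Lemma mem_ideal_gen (A : comNzRingType) (S : A -> Prop) (p : A) :
  S p -> ideal_gen S p.
Proof.
by move=> Sp; exists [:: (1, p)]; rewrite big_seq1 mul1r; split=> // c; rewrite inE => /eqP ->.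
Qed.

Lemma ideal_gen_min (A : comNzRingType) (S J : A -> Prop) :
  is_ideal J -> (forall p, S p -> J p) -> forall p, ideal_gen S p -> J p.
Proof.
move=> idJ SJ _ [s [sS ->]]; have [_ _ JM] := idJ.
by apply: ideal_sum => // c /sS Sc _; apply/JM/SJ.
Qed.

Lemma monomial_ideal_min (k : fieldType) (n : nat) (M : 'X_{1..n} -> Prop)
    (J : {mpoly k[n]} -> Prop) :
  is_ideal J -> (forall m, M m -> J 'X_[m]) -> forall p, monomial_ideal M p -> J p.
Proof.
move=> idJ MJ p Mp; rewrite [p]mpolyE; have [_ _ JM] := idJ.
by apply: ideal_sum => // m /Mp Mm _; rewrite -mul_mpolyC; apply/JM/MJ.
Qed.

Lemma power_monomials_mul (k : fieldType) (n : nat) (E : {set {set 'I_n}}) s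
    (p q : {mpoly k[n]}) :
  monomial_ideal (power_monomials E set0 set0 1) p ->
  monomial_ideal (power_monomials E set0 set0 s) q ->
  monomial_ideal (power_monomials E set0 set0 s.+1) (p * q).
Proof.
move=> Mp Mq m /msuppM_le/allpairsP[[m1 m2] /= [/Mp M1 /Mq M2 ->]].
case: M1 => [[i]|[t1 [sz1 tE1 ct1]]]; first by rewrite inE.
case: M2 => [[i]|[t2 [sz2 tE2 ct2]]]; first by rewrite inE.
right; exists (t1 ++ t2); rewrite size_cat sz1 sz2; split=> //.
  by move=> a; rewrite mem_cat => /orP[/tE1|/tE2].
move=> v; rewrite count_cat mnmDE inE addn0.
by apply: leq_add; [have := ct1 v|have := ct2 v]; rewrite inE addn0.
Qed.

Lemma ideal_pow_edge_ideal (k : fieldType) (n : nat) (G : hypergraph n) s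
    (p : {mpoly k[n]}) :
  ideal_pow (@edge_ideal k n G) s p <->
  monomial_ideal (power_monomials G set0 set0 s) p.
Proof.
have idM t : is_ideal (monomial_ideal (k := k) (power_monomials G set0 set0 t)).
  exact/monomial_ideal_ideal/power_monomials_upward.
split.
- apply: ideal_gen_min => // _ [f [fI ->]].
  elim: s f fI => [|s IH] f fI.
    by move=> m _; right; exists [::].
  rewrite big_ord_recl; apply: power_monomials_mul; last exact: IH.
  apply: ideal_gen_min (fI ord0) => // _ [e eG ->] m.
  rewrite prod_vertices msuppX inE => /eqP ->.
  right; exists [:: e]; split=> // [a|v]; first by rewrite inE => /eqP ->.
  by rewrite /= mnmE !addn0 leq_addr.
- apply: monomial_ideal_min; first exact: ideal_gen_ideal.
  move=> m [[i]|[t [sz tE ct]]]; first by rewrite inE.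
  (* The condition on [t] says that the product of its edges divides x^m; the other factor is a
     cofactor in the ring. *)
  have -> : m = (m - \sum_(a <- t) mesym1 a + \sum_(a <- t) mesym1 a)%MM.
    rewrite submK //; apply/mnm_lepP => v; rewrite mnm_sumE.
    have := ct v; rewrite inE addn0 -sum1_count big_mkcond /=.
    by congr (_ <= _)%N; apply: eq_bigr => a _; rewrite mnmE; case: (v \in a).
  rewrite mpolyXD; have [_ _ JM] := ideal_gen_ideal
    (fun p : {mpoly k[n]} => exists f : 'I_s -> _,
       (forall i, @edge_ideal k n G (f i)) /\ p = \prod_i f i).
  apply: JM; apply: mem_ideal_gen.
  exists (fun i : 'I_s => 'X_[mesym1 (nth set0 t i)]); split.
    move=> i; apply: mem_ideal_gen; exists (nth set0 t i); last by rewrite prod_vertices.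
    by apply/tE/mem_nth; rewrite sz.
  by rewrite -mprodXE (big_nth set0) big_mkord sz.
Qed.

Lemma hits_homog_max_ideal (k : fieldType) (n : nat) (p : {mpoly k[n]}) :
  monomial_ideal (hits setT) p -> homog_max_ideal p.
Proof.
apply: monomial_ideal_min; first exact: ideal_gen_ideal.
move=> m [i _ lt_m].
have [_ _ JM] := ideal_gen_ideal (fun p : {mpoly k[n]} => exists i : 'I_n, p = 'X_i).
have -> : m = (m - U_(i) + U_(i))%MM.
  by rewrite submK //; apply/mnm_lepP => j; rewrite mnm1E; case: eqP => [<-|].
by rewrite mpolyXD; apply/JM/mem_ideal_gen; exists i.
Qed.

Lemma elem_sym_hits (k : fieldType) (n i : nat) :
  monomial_ideal (hits setT) (elem_sym k n i).
Proof.
rewrite /elem_sym mesymE; apply: ideal_sum.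
  exact/monomial_ideal_ideal/hits_upward.
move=> h _ /eqP card_h m; rewrite msuppX inE => /eqP ->.
have /card_gt0P[v vh] : (0 < #|h|)%N by rewrite card_h.
by exists v => //; rewrite mnmE vh.
Qed.

Lemma power_monomials_hits (n : nat) (E : {set {set 'I_n}}) (K : {set 'I_n})
    s (m : 'X_{1..n}) :
  set0 \notin E -> power_monomials E K set0 s.+1 m -> hits setT m.
Proof.
move=> E0 [[i _ lt_m]|[[|a t] [//= _ tE ct]]]; first by exists i.
have /set0Pn[v va] : a != set0.
  by apply: contraNneq E0 => <-; apply: tE; apply: mem_head.
by exists v => //; have := ct v; rewrite /= va inE addn0; apply: leq_trans.
Qed.

(** [hits setT] describes the polynomials without constant term; [J] and all the e_i consist of
    such, so the quotient is nonzero. *)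
Lemma elem_sym_regular_seq (k : fieldType) (n : nat) (J : {mpoly k[n]} -> Prop) d :
  is_ideal J -> (forall p, J p -> monomial_ideal (hits setT) p) ->
  weakly_regular J (elem_sym k n) d ->
  regular_seq (@homog_max_ideal k n) J (mkseq (elem_sym k n) d).
Proof.
move=> idJ Jm reg; split.
- by move=> _ /mapP[i _ ->]; apply/hits_homog_max_ideal/elem_sym_hits.
- move=> i; rewrite size_mkseq => lt_i p.
  rewrite nth_mkseq // /mkseq -map_take take_iota (minn_idPl (ltnW lt_i)).
  by rewrite -!adjoin_firstE //; apply: reg.
- move=> J1; have : monomial_ideal (hits setT) (1 : {mpoly k[n]}).
    apply: ideal_gen_min J1; first exact/monomial_ideal_ideal/hits_upward.
    by move=> p [/Jm//|/mapP[i _ ->]]; apply: elem_sym_hits.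
  by move/(_ 0%MM); rewrite msupp1 mem_head => /(_ isT)[i _]; rewrite mnm0E.
Qed.

Local Close Scope ring_scope.

(** * The depth of powers of edge ideals *)

Theorem power_monomials_regular (k : fieldType) (n : nat)
    (E : {set {set 'I_n}}) (K W : {set 'I_n}) (s d : nat) :
  hereditary_leaf E -> simple_edges E -> set0 \notin E ->
  [disjoint K & cover E] -> [disjoint W & K] -> depth_bound E K W s d ->
  weakly_regular (monomial_ideal (power_monomials E K W s)) (elem_sym k n) d.
Proof.
(* The factor [n.+1] pays for the vertices that leave [W], at most [n], when [s] drops. *)
have [N] := ubnP (n.+1 * s + #|~: W| + #|E|).
elim: N E K W s d => // N IH E K W s d leN leafE simpleE E0 disjE disjW bound.
case: s => [|s] in leN bound *.
  apply: weakly_regular_all => p m _; right; exists [::]; split=> // v.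
case: (eqVneq E set0) => [E_0|/(hereditary_leaf_good_leaf leafE)[e eE chain]].
  apply: (@monomial_ideal_ext _ _ (hits K)) => [m|].
    split=> [Km|[//|[[|a t] [//= _ tE _]]]]; first by left.
    by have := tE a (mem_head _ _); rewrite E_0 inE.
  apply: elem_sym_regular; rewrite -[leqRHS]card_ord -(cardsC K) leq_add2l.
  case: bound => [[le_d1 [v vK _]]|bound].
    by apply: leq_trans le_d1 _; apply/card_gt0P; exists v; rewrite inE.
  (* Without edges the empty family dominates, and the bound becomes d <= n - |K|. *)
  have := bound set0; rewrite E_0 cards0 /cover big_set0 setU0 => bound0.
  suff /bound0 : dominates set0 set0 W by lia.
  by split; rewrite ?sub0set /cover ?big_set0 ?setI0 ?sub0set // => v; rewrite inE.
have [y ye free] := good_leaf_free_vertex simpleE E0 eE chain.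
case: (boolP (e \subset W)) => [eW|neW].
  apply: (@monomial_ideal_ext _ _ (power_monomials E K (W :\: e) s)).
    by move=> m; rewrite (power_monomials_good_leaf _ _ _ eE).
  apply: IH => //.
  - have : #|~: (W :\: e)| <= n by rewrite -[leqRHS](card_ord n) max_card.
    by move: leN; rewrite mulnS; lia.
  - by apply: disjointWl disjW; apply: subsetDl.
  - exact: depth_bound_good_leaf bound.
(* If [e] meets [W], any [z] in [e] outside [W] has a neighbour in [W]. Otherwise [z] is a vertex of
   [e] other than the free vertex [y], which loses its only edge, or [y] itself when [e] is a
   singleton. *)
have [z [ze zW cond]] : exists z, [/\ z \in e, z \notin W & [set z] \in E \/
    exists w, [/\ w \in e, w != z & (w \in W) || (w \notin cover (avoid E z))]].
  case: (boolP [disjoint e & W]) => [disj_eW|].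
    have nW x : x \in e -> x \notin W.
      by move=> xe; rewrite (disjointFr disj_eW).
    case: (boolP (e \subset [set y])) => [sub_y|/subsetPn[x xe]].
      exists y; split=> //; first exact: nW.
      by left; suff <- : e = [set y] by []; apply/eqP; rewrite eqEsubset sub_y sub1set.
    rewrite inE => xy; exists x; split=> //; first exact: nW.
    right; exists y; split=> //; first by rewrite eq_sym.
    apply/orP; right; apply/mem_coverP => -[a]; rewrite inE => /andP[aE xa] ya.
    by rewrite (free a aE ya) xe in xa.
  rewrite -setI_eq0 => /set0Pn[w]; rewrite inE => /andP[we wW].
  have /subsetPn[z ze zW] := neW; exists z; split=> //; right; exists w.
  by split; rewrite ?wW //; apply: contraNneq zW => <-.
have zE : z \in cover E by apply/mem_coverP; exists e.
have zK : z \notin K by apply: contraTN zE => zK; rewrite (disjointFr disjE zK).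
have ltE : #|avoid E z| < #|E|.
  apply/proper_card/properP; split; first exact: avoid_sub.
  by exists e => //; rewrite inE ze andbF.
apply: (@weakly_regular_exact _ _ 'X_z%R).
- exact/monomial_ideal_ideal/power_monomials_upward.
- apply: (@weakly_regular_ext _ (monomial_ideal (power_monomials E K (z |: W) s.+1))).
    move=> p; rewrite monomial_ideal_colon.
    by split=> Mp m /Mp; rewrite power_monomials_colon.
  apply: IH => //.
  + suff : #|~: (z |: W)| < #|~: W| by lia.
    apply/proper_card; rewrite setCU; apply/properP; split; first exact: subsetIr.
    by exists z; rewrite !inE ?eqxx.
  + by rewrite disjoints_subset subUset sub1set -disjoints_subset inE zK.
  + exact: depth_bound_extend.
- apply: (@weakly_regular_ext _
            (monomial_ideal (power_monomials (avoid E z) (z |: K) W s.+1))).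
    move=> p; rewrite monomial_ideal_adjoin1; last exact: power_monomials_upward.
    by split=> Mp m /Mp; rewrite -power_monomials_adjoin.
  have subE := avoid_sub E z.
  apply: IH => //.
  + by lia.
  + by move=> E' /subset_trans/(_ subE); apply: leafE.
  + by move=> a b /(subsetP subE) aE /(subsetP subE) bE; apply: simpleE.
  + by apply: contraNN E0; apply/subsetP.
  + rewrite disjoints_subset subUset sub1set -disjoints_subset inE.
    apply/andP; split.
      by apply/mem_coverP => -[a]; rewrite inE => /andP[_ /negP].
    by apply: disjointWr disjE; apply: cover_sub.
  + rewrite disjoint_sym disjoints_subset subUset sub1set -disjoints_subset inE.
    by rewrite zW disjoint_sym.
  + exact: (depth_bound_avoid simpleE disjE zW eE ze cond bound).
Qed.

(** If no dominating set exists, the number is 0 by convention. Otherwise every vertex lies on an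
    edge, so dominating the covered vertices suffices. *)
Lemma edgewise_domination_number_le (n : nat) (G : hypergraph n)
    (F : {set {set 'I_n}}) :
  dominates G F set0 -> (edgewise_domination_number G <= #|F|)%N.
Proof.
move=> [FG _ dom]; case: (pickP (edgewise_dominant G)) => [F0 domF0|none]; last first.
  rewrite /edgewise_domination_number; case: pickP => // F0.
  by rewrite none.
have [_ minF] := edgewise_domination_numberP domF0; apply: minF.
rewrite /edgewise_dominant FG; apply/forallP => v.
have /andP[_ /forallP/(_ v)] := domF0.
case vG: ([set v] \in edges G) => //= /existsP[u /andP[/andP[_ /existsP[a]]]].
move=> /andP[aG /andP[va _]] _.
have /dom : v \in cover G by apply/mem_coverP; exists a.
rewrite vG => -[//|[b bG [w [vb wb wv /mem_coverP[f fF wf]]]]].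
apply/existsP; exists w; rewrite /adjacent eq_sym wv /=; apply/andP; split.
  by apply/existsP; exists b; rewrite bG vb.
by apply/existsP; exists f; rewrite fF.
Qed.

Theorem theorem3p1 (k : fieldType) (n : nat) (G : hypergraph n)
    (hforest : hyperforest G)
    (hedge : exists2 e : {set 'I_n}, e \in edges G & 2 <= #|e|)
    (s : nat) (hs : 1 <= s) :
  le_enat (maxn (edgewise_domination_number G + 1 - s) 1)
          (depth (@homog_max_ideal k n) (ideal_pow (@edge_ideal k n G) s)).
Proof.
have [e eG card_e] := hedge.
have G0 : set0 \notin edges G.
  apply/negP => G0; have := edges_simple G0 eG (sub0set e).
  by move=> e0; rewrite -e0 cards0 in card_e.
set d := maxn _ _.
have reg : weakly_regular (ideal_pow (@edge_ideal k n G) s) (elem_sym k n) d.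
  apply: (@weakly_regular_ext _ (monomial_ideal (power_monomials G set0 set0 s))).
    by move=> p; rewrite ideal_pow_edge_ideal.
  apply: power_monomials_regular => //.
  - exact: edges_simple.
  - by rewrite -setI_eq0 set0I.
  - by rewrite -setI_eq0 set0I.
  (* If d = 1, any vertex [v] of [e] works: the singleton [[set v]] is not an edge, being properly
     contained in [e]. *)
  case: (leqP (edgewise_domination_number G + 1 - s) 1) => [le1|gt1].
    left; split; first by rewrite /d (maxn_idPr le1).
    have /card_gt0P[v ve] : 0 < #|e| by apply: ltnW.
    exists v; first by rewrite inE.
    apply/negP => vG; have := edges_simple vG eG; rewrite sub1set => /(_ ve) ve1.
    by rewrite -ve1 cards1 in card_e.
  (* Here the truncated subtraction is exact, so d + s is the domination number plus one. *)
  right=> F /edgewise_domination_number_le le_F.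
  rewrite /d (maxn_idPl (ltnW gt1)) subnK; last by lia.
  by rewrite leq_add2r (leq_trans le_F) // leq_addr.
have : is_depth _ _ _ := depthP (@homog_max_ideal k n) (ideal_pow (@edge_ideal k n G) s).
(* Infinite depth, encoded as [None], satisfies every lower bound. *)
case: (depth _ _) => //= b [_ ub _].
rewrite -(size_mkseq (elem_sym k n) d); apply/ub/elem_sym_regular_seq => //.
  exact: ideal_gen_ideal.
move=> p; rewrite ideal_pow_edge_ideal => Ip m /Ip.
by case: s hs {d reg ub Ip} => // s _; apply: power_monomials_hits.
Qed.
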